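(* Let $\mathcal U=\{u_n\}_{n\ge1}$ be an admissible divisibility sequence of moderate growth, let $\mathfrak U=\{n\in\mathbb N: n\mid u_n\}$ and $U(x)=|\mathfrak U\cap[1,x]|$. Then for every positive integer $n$ there exist positive constants $x(n,\mathcal U)$ and $c(n,\mathcal U)$ such that for every $x>x(n,\mathcal U)$, $$U(x)\gg_n e_n\big(c(n,\mathcal U)(\ln_{n+1}x)^2\big).$$
   Context: A sequence of integers $\mathcal U=\{u_n\}$ is an admissible divisibility sequence of moderate growth if: (1) if $n\mid m$ then $u_n\mid u_m$; (2) if a prime $p$ divides $u_n$ then $p u_n\mid u_{pn}$; (3) for all positive integers $n$ with finitely many exceptions there is a prime $p$ with $p\mid u_n$ but $p\nmid u_k$ for all $k<n$; (4) there exists $a>0$ with $u_n\ll a^n$; (5) $u_1\ne\pm1$. Iterated functions: $e_0(x)=x=\ln_0(x)$, $e_{i+1}(x)=e^{e_i(x)}$, $\ln_{i+1}(x)=\ln(\ln_i(x))$. *)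

(* Defs.v *)
From HB Require Import structures.
From mathcomp Require Import all_boot all_order all_algebra finmap.
From mathcomp Require Import all_classical all_reals all_analysis.
Set Implicit Arguments.
Unset Strict Implicit.
Unset Printing Implicit Defensive.
Import Order.TTheory GRing.Theory Num.Theory.
Local Open Scope classical_set_scope.
Local Open Scope ring_scope.

(* A sequence {u_n}_{n >= 1} of integers is a function u : nat -> int whose
   value at 0 is never used: every condition below is restricted to positive
   indices. *)

Definition primitive_divisor (u : nat -> int) (n p : nat) : Prop :=
  [/\ prime p, (p %| u n)%Z
    & forall k : nat, (0 < k < n)%N -> ~~ (p %| u k)%Z].

Record admissible (R : realType) (u : nat -> int) : Prop := Admissible {
  adm_dvd : forall n m : nat, (0 < n)%N -> (0 < m)%N ->
    (n %| m)%N -> (u n %| u m)%Z ;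
  adm_prime : forall n p : nat, (0 < n)%N -> prime p ->
    (p %| u n)%Z -> (p%:Z * u n %| u (p * n)%N)%Z ;
  adm_primitive :
    finite_set [set n : nat | (0 < n)%N /\ ~ exists p, primitive_divisor u n p] ;
  adm_growth : exists a C : R, 0 < a /\
    forall n : nat, (0 < n)%N -> `|(u n)%:~R : R| <= C * a ^+ n ;
  adm_one : u 1%N <> 1 /\ u 1%N <> -1
}.

Definition self_divisors (u : nat -> int) : set nat :=
  [set n : nat | (0 < n)%N /\ (n %| u n)%Z].

Definition self_divisors_upto (R : realType) (u : nat -> int) (x : R)
  : set nat :=
  self_divisors u `&` [set n : nat | 1 <= (n%:R : R) <= x].

(* fset_set returns the empty set on infinite sets; this shows that the
   default value plays no role in the definition of Ucount. *)
Lemma finite_self_divisors_upto (R : realType) (u : nat -> int) (x : R) :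
  finite_set (self_divisors_upto u x).
Proof.
apply: (@sub_finite_set _ _ `I_(Num.truncn x).+1); last exact: finite_II.
move=> n [_ /= /andP[n1 nx]]; rewrite ltnS.
by rewrite truncn_ge_nat // (le_trans _ nx).
Qed.

Definition Ucount (R : realType) (u : nat -> int) (x : R) : nat :=
  #|` fset_set (self_divisors_upto u x)|%fset.

Definition iexp (R : realType) (i : nat) (x : R) : R := iter i (@expR R) x.

(* ln is total, with value 0 at non-positive arguments; ln_i(x) is the genuine
   iterated logarithm for all sufficiently large x. *)
Definition iln (R : realType) (i : nat) (x : R) : R := iter i (@ln R) x.

(* Main.v *)
Require Import Defs.
From mathcomp Require Import all_boot all_order all_algebra finmap.
From mathcomp Require Import all_classical all_reals all_analysis.
From mathcomp Require Import zify ring lra.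
Import Order.TTheory GRing.Theory Num.Theory.
Local Open Scope ring_scope.

(** If [n] divides [u n] and a prime [p] divides [u n], then [p * n] divides
    [u (p * n)]; moreover self-divisors are closed under lcm. Let [L] be the lcm
    of the self-divisors [m <= Y], each of which (up to finitely many) carries a
    primitive prime [q m] of [u m]. The [q m] are distinct and divide [u L], so
    every product of [L] with a subset of them is again a self-divisor, of size
    at most [B ^ (Y ^ 2)] by moderate growth. Hence
    [2 ^ (U(Y) - C) <= U(B ^ (Y ^ 2))], and each use of this inequality, with
    [Y] about [sqrt (ln x / ln B)], adds one exponential to a lower bound.
    The induction starts one level below the theorem, at
    [U(x) >= c * (ln x) ^ 2], which comes from the self-divisors
    [N * p ^ i * q ^ j] for two fixed primes. *)

(** * Counting self-divisors up to a natural bound *)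

Definition self_count (u : nat -> int) (Y : nat) : nat :=
  #|[pred m : 'I_Y.+1 | (0 < m)%N && (m%:Z %| u m)%Z]|.

Lemma self_count_homo (u : nat -> int) :
  {homo self_count u : Y Z / (Y <= Z)%N}.
Proof.
move=> Y Z YZ; have YZ1 : (Y.+1 <= Z.+1)%N by [].
have wI : injective (widen_ord YZ1) by move=> i j /(congr1 val)/= /val_inj.
rewrite /self_count -(fintype.card_image wI); apply/subset_leq_card/fintype.subsetP.
by move=> _ /fintype.imageP[i iP ->].
Qed.

(** Source of all lower bounds: [A] is a powerset for the exponential inequality and a set of
    exponent pairs for two primes. *)
Lemma leq_self_count (u : nat -> int) (Y : nat) (I : finType) (A : {pred I})
    (f : I -> nat) :
  {in A &, injective f} ->
  (forall i, i \in A ->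
     [&& (0 < f i)%N, (f i <= Y)%N & ((f i)%:Z %| u (f i))%Z]) ->
  (#|A| <= self_count u Y)%N.
Proof.
move=> fI fP.
have gI : {in A &, injective (fun i => inord (f i) : 'I_Y.+1)}.
  move=> i j iA jA /(congr1 val)/=.
  have /and3P[_ iY _] := fP _ iA; have /and3P[_ jY _] := fP _ jA.
  by rewrite !inordK // => /fI; apply.
rewrite -(fintype.card_in_image gI); apply/subset_leq_card/fintype.subsetP.
move=> _ /fintype.imageP[i iA ->]; rewrite inE.
by have /and3P[i0 iY id] := fP _ iA; rewrite inordK // i0 id.
Qed.

Lemma self_count_Ucount (R : realType) (u : nat -> int) (x : R) :
  0 <= x -> (self_count u (Num.truncn x) <= Ucount u x)%N.
Proof.
move=> x0; rewrite /self_count /Ucount cardE -(size_map val).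
rewrite uniq_leq_size //.
  by rewrite map_inj_uniq ?enum_uniq //; exact: val_inj.
move=> _ /mapP[i + ->]; rewrite mem_enum inE => /andP[i0 id].
rewrite in_fset_set; last exact: finite_self_divisors_upto.
rewrite inE; split; first by split.
by rewrite /= ler1n i0 /= -truncn_ge_nat // -ltnS ltn_ord.
Qed.

(** * Arithmetic of admissible sequences *)

Section Admissible.
Context (R : realType) (u : nat -> int) (adm : admissible R u).

(** Adjoin one prime at a time: [p * n] divides [p * u n], which divides [u (p * n)], and the
    remaining primes still divide [u (p * n)]. Repetitions in [s] are allowed. *)
Lemma self_dvd_mul_primes (n : nat) (s : seq nat) :
  (0 < n)%N -> (n%:Z %| u n)%Z ->
  (forall p, p \in s -> prime p /\ (p%:Z %| u n)%Z) ->
  ((n * \prod_(p <- s) p)%N%:Z %| u (n * \prod_(p <- s) p)%N)%Z.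
Proof.
elim: s n => [|p s IH] n n0 nd sP; first by rewrite big_nil muln1.
have [pp pd] := sP p (mem_head _ _).
rewrite big_cons mulnA [(n * p)%N]mulnC; apply: IH.
- by rewrite muln_gt0 prime_gt0.
- apply: dvdz_trans (adm_prime adm n0 pp pd).
  by rewrite PoszM dvdz_mul.
- move=> q qs; have [|qp qd] := sP q; first by rewrite inE qs orbT.
  split=> //; apply: dvdz_trans qd _.
  apply: (adm_dvd adm) => //; last by rewrite dvdn_mull.
  by rewrite muln_gt0 n0 prime_gt0.
Qed.

Lemma primitive_divisor_eventually : exists E : nat, forall n : nat,
  (0 < n)%N -> (E <= n)%N -> exists p, primitive_divisor u n p.
Proof.
have /finite_seqP[s sE] := adm_primitive adm.
exists (\max_(i <- s) i).+1 => n n0 nE; apply: contrapT => nP.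
have : n \in s by have : [set` s]%classic n by rewrite -sE.
move=> ns; have := leq_bigmax_seq (F := id) n ns isT.
by rewrite leqNgt nE.
Qed.

(** Every prime divides 0, so a zero at [n] would rule out primitive divisors at larger indices. *)
Lemma admissible_neq0 (n : nat) : (0 < n)%N -> u n != 0.
Proof.
move=> n0; apply/eqP => un0; have [E EP] := primitive_divisor_eventually.
have [||p [pp _ /(_ n)]] := EP (n * E.+2)%N.
- by rewrite muln_gt0 n0.
- by nia.
rewrite un0 dvdz0 => /(_ _)/negP; case => //.
by rewrite n0 /=; nia.
Qed.

Lemma growth_nat : exists A : nat, (0 < A)%N /\
  forall n, (0 < n)%N -> (`|u n|%N <= A ^ n)%N.
Proof.
have [a [C [a0 aC]]] := adm_growth adm.
(* Since [n] is positive, the constant factor [C] can be absorbed into the base. *)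
pose A := ((Num.truncn `|C|).+1 * (Num.truncn a).+1)%N.
exists A; split=> // n n0; rewrite -(ler_nat R) natr_absz intr_norm.
apply: le_trans (aC n n0) _; rewrite /A expnMn natrM.
apply: (@le_trans _ _ (`|C| * a ^+ n)).
  by rewrite ler_wpM2r ?exprn_ge0 ?ler_norm // ltW.
apply: ler_pM => //; first by rewrite exprn_ge0 ?ltW.
  apply: (@le_trans _ _ (Num.truncn `|C|).+1%:R).
    exact/ltW/truncnS_gt.
  rewrite ler_nat -{1}(expn1 (Num.truncn _).+1) leq_pexp2l //.
rewrite natrX lerXn2r ?nnegrE ?ler0n ?ltW //.
exact: truncnS_gt.
Qed.

Lemma self_count_exp : exists B C : nat, (1 < B)%N /\
  forall Y : nat, (2 ^ (self_count u Y - C) <= self_count u (B ^ (Y ^ 2)))%N.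
Proof.
have [E EP] := primitive_divisor_eventually; have [A [A0 AP]] := growth_nat.
have /choice[q qP] : forall n, exists p, (0 < n)%N -> (E <= n)%N ->
    primitive_divisor u n p.
  move=> n; have [/andP[n0 nE]|nn] := boolP ((0 < n) && (E <= n))%N.
    by have [p pP] := EP n n0 nE; exists p.
  by exists 0%N => n0 nE; rewrite n0 nE in nn.
(* The factor 2 pays for [L], the factor [A] for the product of the primes [q m]; [E] bounds the
   number of self-divisors below [E], which are discarded. *)
exists (2 * A)%N, E; split=> [|Y]; first by nia.
pose S := finset.finset (fun m : 'I_Y.+1 =>
  [&& (0 < m)%N, (E <= m)%N & (m%:Z %| u m)%Z]).
have SP m : m \in S -> [/\ (0 < m)%N, (E <= m)%N & (m%:Z %| u m)%Z].
  by rewrite finset.inE => /and3P.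
have Sq m : m \in S -> primitive_divisor u m (q m).
  by move=> /SP[m0 mE _]; apply: qP.
have sizeS : (self_count u Y - E <= #|S|)%N.
  rewrite leq_subLR addnC /self_count.
  rewrite -[leqLHS](cardID (fun m : 'I_Y.+1 => (E <= m)%N)); apply: leq_add.
    apply/subset_leq_card/fintype.subsetP => m.
    by rewrite !inE => /andP[/andP[-> ->] ?]; rewrite andbT.
  rewrite -[leqRHS](size_iota 0) cardE -(size_map val) uniq_leq_size //.
    by rewrite map_inj_uniq ?enum_uniq //; exact: val_inj.
  move=> _ /mapP[m + ->]; rewrite mem_enum !inE mem_iota add0n /=.
  by rewrite -ltnNge => /andP[].
(* For [m < m'], primitivity forbids [q m'] from dividing [u m], whereas [q m] does. *)
have qI (m m' : 'I_Y.+1) : m \in S -> m' \in S -> q m = q m' -> m = m'.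
  wlog mm : m m' / (m <= m')%N.
    move=> W mS mS' e; have [|/ltnW] := leqP m m' => h; first exact: W.
    by apply/esym; apply: W.
  move=> mS mS' e; apply/val_inj => /=; move: mm.
  rewrite leq_eqVlt => /orP[/eqP//|mm].
  have [_ d _] := Sq _ mS; have [_ _ /(_ m)] := Sq _ mS'.
  by rewrite -e d mm => /(_ _)/negP; case=> //; have [->] := SP _ mS.
pose L := (\big[lcmn/1%N]_(m in S) m)%N.
have Ldvd (m : 'I_Y.+1) : m \in S -> (m %| L)%N.
  by move=> mS; apply: (biglcmn_sup m).
have Lprod : (L %| \prod_(m in S) m)%N.
  by apply/dvdn_biglcmP => m mS; rewrite (bigD1 m) //= dvdn_mulr.
have L0 : (0 < L)%N.
  apply: dvdn_gt0 Lprod; rewrite prodn_cond_gt0 // => m mS.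
  by have [] := SP _ mS.
have Lself : (L%:Z %| u L)%Z.
  rewrite dvdzE /=; apply/dvdn_biglcmP => m mS.
  have [m0 _ md] := SP _ mS.
  rewrite -[X in (X %| _)%N]/(`|m%:Z|%N) -dvdzE.
  by apply: dvdz_trans md _; apply: (adm_dvd adm) => //; apply: Ldvd.
(* Index 0 is not in [S], so there are at most [Y] factors rather than [Y + 1]; this gives the exact
   exponent [Y ^ 2]. *)
have prod_bound (T : {set 'I_Y.+1}) (b : nat) (g : 'I_Y.+1 -> nat) :
    {subset T <= S} -> (0 < b)%N -> (forall m, m \in T -> (g m <= b ^ Y)%N) ->
    (\prod_(m in T) g m <= b ^ (Y ^ 2))%N.
  move=> TS b0 gb; apply: leq_trans (leq_prod gb) _.
  rewrite prod_nat_const -expnM leq_pexp2l // -mulnn leq_mul //.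
  have : T \subset ([set: 'I_Y.+1] :\ ord0)%SET.
    apply/fintype.subsetP => m /TS /SP[m0 _ _].
    by rewrite !finset.inE andbT -val_eqE /= -lt0n.
  move=> /subset_leq_card; rewrite -(leq_add2l (ord0 \in [set: 'I_Y.+1]%SET)).
  by rewrite -cardsD1 cardsT card_ord finset.in_setT add1n.
pose f (T : {set 'I_Y.+1}) := (L * \prod_(m in T) q m)%N.
apply: leq_trans (leq_pexp2l _ sizeS) _ => //.
rewrite -card_powerset; apply: (@leq_self_count _ _ _ _ f).
- move=> T T'; rewrite !powersetE => /fintype.subsetP TS /fintype.subsetP TS'.
  move=> /eqP; rewrite eqn_pmul2l // => /eqP e.
  (* A prime [q m] dividing a product of primes [q m'] is one of them, so the product determines the
     set. *)
  have mem (T1 T2 : {set 'I_Y.+1}) : {subset T1 <= S} -> {subset T2 <= S} ->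
      (\prod_(m in T1) q m)%N = (\prod_(m in T2) q m)%N -> {subset T1 <= T2}.
    move=> s1 s2 e12 m mT; have [qp _ _] := Sq _ (s1 _ mT).
    have : (q m %| \prod_(m in T2) q m)%N.
      by rewrite -e12 (bigD1 m) //= dvdn_mulr.
    rewrite Euclid_dvd_prod // big_has_cond => /hasP[m' _ /andP[mT']].
    have [qp' _ _] := Sq _ (s2 _ mT'); rewrite dvdn_prime2 // => /eqP /qI ->//.
      exact: s1.
    exact: s2.
  by apply/setP => m; apply/idP/idP; apply: mem.
- move=> T; rewrite powersetE => /fintype.subsetP TS.
  have fE : f T = (L * \prod_(p <- [seq q (val m) | m <- enum T]) p)%N.
    by rewrite /f big_map big_enum.
  apply/and3P; split.
  + rewrite muln_gt0 L0 prodn_cond_gt0 // => m mT.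
    by have [/prime_gt0] := Sq _ (TS _ mT).
  + rewrite /f expnMn leq_mul //.
      apply: leq_trans (dvdn_leq _ Lprod) _.
        by rewrite prodn_cond_gt0 // => m mS; have [] := SP _ mS.
      apply: prod_bound => // m _; apply/ltnW/(leq_trans (ltn_expl m (isT : 1 < 2)%N)).
      by rewrite leq_pexp2l // -ltnS.
    apply: prod_bound => // m /TS mS; have [m0 _ _] := SP _ mS.
    have [_ qd _] := Sq _ mS.
    apply: (@leq_trans `|u m|%N).
      by rewrite dvdn_leq ?absz_gt0 ?admissible_neq0 // -[q m]absz_nat -dvdzE.
    by apply: leq_trans (AP m m0) _; rewrite leq_pexp2l // -ltnS.
  + rewrite fE; apply: self_dvd_mul_primes => // _ /mapP[m + ->].
    rewrite mem_enum => /TS mS; have [qp qd _] := Sq _ mS; split=> //.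
    apply: dvdz_trans qd _; have [m0 _ _] := SP _ mS.
    by apply: (adm_dvd adm) => //; apply: Ldvd.
Qed.

(** A prime [p] dividing [u 1] makes every power of [p] a self-divisor. A primitive prime [q] of
    [u N], with [N] a large power of [p], is a second prime, and the numbers [N * p ^ i * q ^ j]
    with [i, j <= M] are counted. *)
Lemma self_count_two_primes : exists N P : nat, [/\ (0 < N)%N, (1 < P)%N &
  forall M : nat, (M.+1 ^ 2 <= self_count u (N * P ^ (2 * M)))%N].
Proof.
have [E EP] := primitive_divisor_eventually.
have [p pp pd] : exists2 p, prime p & (p%:Z %| u 1%N)%Z.
  have [u1 uN1] := adm_one adm.
  exists (pdiv `|u 1%N|%N); last by rewrite dvdzE /= pdiv_dvd.
  apply: pdiv_prime; have := admissible_neq0 1 isT; lia.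
have pX k : ((p ^ k)%N%:Z %| u (p ^ k)%N)%Z.
  have := @self_dvd_mul_primes 1 (nseq k p) isT.
  rewrite mul1n big_nseq iter_muln_1.
  by apply; rewrite ?dvd1z // => r /nseqP[->].
(* The exponent makes the index at least [E] and also greater than 1, so that [q] cannot divide
   [u 1] and differs from [p]. *)
have [||q [qp qd qN]] := EP (p ^ E.+1)%N.
- by rewrite expn_gt0 prime_gt0.
- by apply/ltnW/ltnW; rewrite ltn_expl // prime_gt1.
have pq : p != q.
  apply/eqP => e; have := qN 1%N; rewrite -e pd => /(_ _)/negP; case=> //=.
  by rewrite -{1}(expn0 p) ltn_exp2l // prime_gt1.
have pd' : (p%:Z %| u (p ^ E.+1)%N)%Z.
  apply: dvdz_trans pd _; apply: (adm_dvd adm) => //.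
  by rewrite expn_gt0 prime_gt0.
have N0 : (0 < p ^ E.+1)%N by rewrite expn_gt0 prime_gt0.
have P1 : (1 < maxn p q)%N by rewrite leq_max prime_gt1.
exists (p ^ E.+1)%N, (maxn p q); split=> // M.
have leq_expP r (i : 'I_M.+1) : (r <= maxn p q -> r ^ i <= maxn p q ^ M)%N.
  move=> rP; apply: (@leq_trans (maxn p q ^ i)%N).
    by case: (i : nat) => // k; rewrite leq_exp2r.
  by rewrite leq_pexp2l ?(ltnW P1) // -ltnS.
rewrite -mulnn -[M.+1 in leqLHS]card_ord -card_prod.
pose f (ij : 'I_M.+1 * 'I_M.+1) := (p ^ E.+1 * (p ^ ij.1 * q ^ ij.2))%N.
apply: (@leq_self_count _ _ _ _ f).
- move=> [i j] [i' j'] _ _ /eqP; rewrite /f eqn_pmul2l //= => /eqP e.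
  have cpq : coprime p q by rewrite prime_coprime // dvdn_prime2.
  have e1 := congr1 (logn p) e; have e2 := congr1 (logn q) e.
  move: e1 e2; rewrite !lognM ?expn_gt0 ?prime_gt0 // !lognX !logn_prime //.
  rewrite !eqxx (negbTE pq) eq_sym (negbTE pq) !muln1 !muln0 !addn0 !add0n.
  by move=> /val_inj -> /val_inj ->.
- move=> [i j] _; rewrite /f /=; apply/and3P; split.
  + by rewrite !muln_gt0 N0 !expn_gt0 !prime_gt0.
  + rewrite leq_mul // mul2n -addnn expnD.
    by rewrite leq_mul ?leq_expP ?leq_maxl ?leq_maxr.
  + have := @self_dvd_mul_primes _ (nseq i p ++ nseq j q) N0 (pX _).
    rewrite big_cat !big_nseq !iter_muln_1; apply=> r.
    by rewrite mem_cat => /orP[] /nseqP[->].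
Qed.

End Admissible.

(** * Iterated exponentials and logarithms, and the induction *)

Section Analysis.
Context {R : realType}.
Local Open Scope classical_set_scope.

Lemma ln_cvgy : ln x @[x --> (+oo : set_system R)] --> +oo.
Proof.
apply/cvgryPge => A; near=> x.
have Ax : expR A <= x by near: x; apply: nbhs_pinfty_ge; exact: num_real.
by rewrite -(expRK A) ler_ln ?posrE ?expR_gt0 // (lt_le_trans (expR_gt0 A)).
Unshelve. all: by end_near. Qed.

Lemma iln_cvgy (n : nat) : iln n x @[x --> (+oo : set_system R)] --> +oo.
Proof.
elim: n => [|n IH]; first exact: cvg_id.
rewrite /iln; under eq_fun do rewrite iterS.
exact: cvg_comp IH ln_cvgy.
Qed.

Lemma iexp_homo (n : nat) : {homo @iexp R n : x y / x <= y}.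
Proof. by move=> x y xy; elim: n => //= n IH; rewrite ler_expR. Qed.

Lemma le_iexp (n : nat) (x : R) : x <= iexp n x.
Proof.
elim: n => //= n IH; apply: le_trans IH (le_trans _ (expR_ge1Dx _)).
by rewrite lerDr.
Qed.

(** Shrinking [c] absorbs affine losses. Below the outer exponential a factor [A / 2] is an additive
    constant, handled by induction; the other half of [A] covers [B], since [iexp] grows at least
    linearly. *)
Lemma iexp_affine (n : nat) (A B c : R) : 0 < A -> 0 < c ->
  exists c' : R, 0 < c' /\
    \forall t \near +oo, iexp n (c' * t) <= A * iexp n (c * t) - B.
Proof.
elim: n A B c => [|n IH] A B c A0 c0.
  exists (A * c / 2); split; first by rewrite !mulr_gt0 ?invr_gt0.
  near=> t.
  have : 2 * B / (A * c) <= t.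
    by near: t; apply: nbhs_pinfty_ge; exact: num_real.
  rewrite ler_pdivrMr ?mulr_gt0 //= => h; lra.
have [c' [c'0 H]] := IH 1 (- ln (A / 2)) c ltr01 c0.
exists c'; split=> //; near=> t.
have h1 : iexp n (c' * t) <= 1 * iexp n (c * t) - - ln (A / 2) by near: t.
have h2 : 2 * B / (A * c) <= t.
  by near: t; apply: nbhs_pinfty_ge; exact: num_real.
move: h1; rewrite mul1r opprK -ler_expR expRD lnK ?posrE ?divr_gt0 // => h1.
have h3 := le_iexp n.+1 (c * t).
have h4 : 2 * B <= A * (c * t).
  by move: h2; rewrite ler_pdivrMr ?mulr_gt0 // => h2; lra.
have h5 : A * (c * t) <= A * iexp n.+1 (c * t) by rewrite ler_pM2l.
by rewrite /= in h1 h5 *; lra.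
Unshelve. all: by end_near. Qed.

Lemma sqrt_ln_trunc (B : nat) : (1 < B)%N ->
  exists (Y : R -> nat) (D : R), [/\ 0 < D,
    (Y x)%:R @[x --> +oo] --> (+oo : set_system R),
    \forall x \near +oo, ln x <= D * (Y x)%:R ^+ 2 &
    \forall x \near +oo, (B ^ (Y x ^ 2))%:R <= x].
Proof.
move=> B1; have lB0 : 0 < ln (B%:R : R) by rewrite ln_gt0 // ltr1n.
pose s x : R := Num.sqrt (ln x / ln B%:R).
have s_cvg : s x @[x --> +oo] --> +oo.
  apply/cvgryPge => A; near=> x.
  have lnx : A ^+ 2 * ln B%:R <= ln x.
    by near: x; apply: (cvgry_ge ln_cvgy).
  rewrite -ler_pdivlMr // in lnx.
  rewrite (le_trans (ler_norm A)) // -sqrtr_sqr ler_sqrt //.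
  by rewrite (le_trans _ lnx) ?sqr_ge0.
have s2 x : 0 <= ln x -> s x ^+ 2 * ln B%:R = ln x.
  by move=> x0; rewrite sqr_sqrtr ?divfK ?gt_eqF // divr_ge0 // ltW.
(* The 4 comes from [s x < Y + 1 <= 2 * Y], squared, where [Y] is the truncation of [s x],
   eventually at least 1. *)
exists (fun x => Num.truncn (s x)), (4 * ln B%:R); split.
- by rewrite mulr_gt0.
- apply/cvgryPge => A; near=> x.
  have As : A + 1 <= s x by near: x; apply: (cvgry_ge s_cvg).
  have := truncnS_gt (s x); rewrite -natr1; lra.
- near=> x.
  have lx0 : 0 <= ln x by near: x; apply: (cvgry_ge ln_cvgy).
  have s1 : 1 <= s x by near: x; apply: (cvgry_ge s_cvg).
  have t1 : 1 <= (Num.truncn (s x))%:R :> R.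
    by rewrite ler1n truncn_ge_nat // (le_trans ler01).
  have := truncnS_gt (s x); rewrite -natr1 -[ln x](s2 x lx0) => h.
  rewrite [4 * _ * _]mulrAC ler_pM2r //.
  have : s x ^+ 2 <= (2 * (Num.truncn (s x))%:R) ^+ 2.
    by rewrite ler_sqr ?nnegrE; lra.
  by rewrite exprMn; lra.
- near=> x.
  have lx0 : 0 <= ln x by near: x; apply: (cvgry_ge ln_cvgy).
  have x0 : 0 < x by near: x; apply: nbhs_pinfty_gt; exact: num_real.
  have B0 : 0 < B%:R :> R by rewrite ltr0n ltnW.
  rewrite natrX -ler_ln ?posrE ?exprn_gt0 // lnXn // -[_ *+ _]mulr_natl -(s2 x lx0).
  rewrite ler_pM2r // natrX ler_sqr ?nnegrE ?ler0n ?sqrtr_ge0 //.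
  by rewrite truncn_le sqrtr_ge0.
Unshelve. all: by end_near. Qed.

(** Taking logarithms gives [ln (ln x) <= ln D + 2 * ln (y x)], where [ln D] is at most half of the
    left side. Each further logarithm turns the factor 1/4 into the loss [ln 4], which is again
    absorbed by 1/4. *)
Lemma iln_quarter (y : R -> R) (D : R) : 0 < D ->
  y x @[x --> +oo] --> +oo -> (\forall x \near +oo, ln x <= D * y x ^+ 2) ->
  forall n, \forall x \near +oo, iln n.+2 x / 4 <= iln n.+1 (y x).
Proof.
move=> D0 y_cvg yD; elim=> [|n IH]; near=> x.
  have y1 : 1 <= y x by near: x; apply: (cvgry_ge y_cvg).
  have lx1 : 1 <= ln x by near: x; apply: (cvgry_ge ln_cvgy).
  have llx : 2 * ln D <= ln (ln x) by near: x; apply: (cvgry_ge (iln_cvgy 2)).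
  have y0 : 0 < y x by lra.
  have : ln (ln x) <= ln (D * y x ^+ 2).
    rewrite ler_ln ?posrE ?mulr_gt0 ?exprn_gt0 //; last by lra.
    by near: x.
  rewrite lnM ?posrE ?exprn_gt0 // lnXn // mulr2n /=; lra.
have h : iln n.+2 x / 4 <= iln n.+1 (y x) by near: x.
have i1 : 1 <= iln n.+2 x by near: x; apply: (cvgry_ge (iln_cvgy _)).
have i2 : 2 * ln 4 <= iln n.+3 x by near: x; apply: (cvgry_ge (iln_cvgy _)).
have : ln (iln n.+2 x / 4) <= ln (iln n.+1 (y x)) by rewrite ler_ln ?posrE; lra.
have ln40 : 0 <= ln (4 : R) by rewrite ln_ge0 // ler1n.
rewrite lnM ?posrE ?invr_gt0 // ?lnV ?posrE //; last by lra.
by move: i2; rewrite /=; lra.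
Unshelve. all: by end_near. Qed.

(** Induction on [n]: two primes give the base case, and [self_count_exp] adds an exponential. *)
Lemma self_count_lower (u : nat -> int) (n : nat) : admissible R u ->
  exists c : R, 0 < c /\ \forall x \near +oo,
    iexp n (c * iln n.+1 x ^+ 2) <= (self_count u (Num.truncn x))%:R.
Proof.
move=> adm; elim: n => [|n [c [c0 IH]]].
  have [N [P [N0 P1 NP]]] := self_count_two_primes R u adm.
  have lP0 : 0 < ln (P%:R : R) by rewrite ln_gt0 // ltr1n.
  have P0 : 0 < P%:R :> R by rewrite ltr0n ltnW.
  have N0' : 0 < N%:R :> R by rewrite ltr0n.
  exists ((4 * ln P%:R) ^- 2).
  split; first by rewrite invr_gt0 exprn_gt0 ?mulr_gt0.
  near=> x.
  have x0 : 0 < x by near: x; apply: nbhs_pinfty_gt; exact: num_real.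
  have lx0 : 0 <= ln x by near: x; apply: (cvgry_ge ln_cvgy).
  have lx : 2 * ln N%:R <= ln x by near: x; apply: (cvgry_ge ln_cvgy).
  (* This [m] solves [N * P ^ (2 * m) = x] over the reals; [lx] gives [m >= ln x / (4 * ln P)],
     whence the constant. *)
  pose m := (ln x - ln N%:R) / (2 * ln P%:R).
  have m0 : 0 <= m by apply: divr_ge0; lra.
  have lm : ln x / (4 * ln P%:R) <= m.
    by rewrite ler_pdivlMr ?mulr_gt0 // mulrAC ler_pdivrMr ?mulr_gt0 //; nra.
  have /andP[tm mt] := truncn_itv m0.
  apply: (@le_trans _ _ ((Num.truncn m).+1 ^ 2)%:R).
    rewrite /= mulrC -exprVn -exprMn natrX ler_sqr ?nnegrE ?ler0n //.
      by rewrite (le_trans lm) // ltW.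
    by rewrite divr_ge0 // mulr_ge0 // ltW.
  rewrite ler_nat; apply: leq_trans (NP _) _; apply: self_count_homo.
  rewrite truncn_ge_nat ?(ltW x0) //.
  rewrite natrM natrX -ler_ln ?posrE ?mulr_gt0 ?exprn_gt0 //.
  rewrite lnM ?posrE ?exprn_gt0 // lnXn // -[_ *+ (_ * _)]mulr_natl natrM.
  by move: tm; rewrite ler_pdivlMr ?mulr_gt0 //; lra.
have [B [C [B1 BC]]] := self_count_exp R u adm.
have [Y [D [D0 Ycvg YD YB]]] := sqrt_ln_trunc _ B1.
have ln20 : 0 < ln (2 : R) by rewrite ln_gt0 // ltr1n.
(* The 16 is the square of the 4 in [iln_quarter]; the next line absorbs [ln 2] and [C], which come
   from writing [2 ^ (k - C)] as an exponential. *)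
have c16 : 0 < c / 16 by rewrite divr_gt0.
have [c' [c'0 H]] := iexp_affine n _ (ln 2 * C%:R) _ ln20 c16.
exists c'; split=> //.
have t_cvg : iln n.+2 x ^+ 2 @[x --> +oo] --> (+oo : set_system R).
  apply/cvgryPge => A; near=> x.
  have i1 : 1 <= iln n.+2 x by near: x; apply: (cvgry_ge (iln_cvgy _)).
  have iA : A <= iln n.+2 x by near: x; apply: (cvgry_ge (iln_cvgy _)).
  by rewrite expr2; nra.
near=> x.
have x0 : 0 <= x by near: x; apply: nbhs_pinfty_ge; exact: num_real.
have i1 : 0 <= iln n.+2 x by near: x; apply: (cvgry_ge (iln_cvgy _)).
have iq : iln n.+2 x / 4 <= iln n.+1 ((Y x)%:R : R).
  by near: x; apply: iln_quarter D0 Ycvg YD n.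
have hY : iexp n (c * iln n.+1 ((Y x)%:R : R) ^+ 2) <= (self_count u (Y x))%:R.
  (* [Y x] is rewritten as the truncation of its real image, so that the induction hypothesis can be
     pulled back along [Ycvg]. *)
  by rewrite -{2}(@natrK R (Y x)); near: x; apply: Ycvg IH.
have hx : iexp n (c' * iln n.+2 x ^+ 2)
    <= ln 2 * iexp n (c / 16 * iln n.+2 x ^+ 2) - ln 2 * C%:R.
  by near: x; apply: t_cvg H.
have h16 : iexp n (c / 16 * iln n.+2 x ^+ 2) <= (self_count u (Y x))%:R.
  apply: le_trans hY; apply: iexp_homo.
  rewrite -mulrA ler_pM2l //.
  have -> : 16^-1 * iln n.+2 x ^+ 2 = (iln n.+2 x / 4) ^+ 2 by field.
  by rewrite ler_sqr ?nnegrE //; lra.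
apply: (@le_trans _ _ (2 ^ (self_count u (Y x) - C))%:R); last first.
  rewrite ler_nat; apply: leq_trans (BC _) _; apply: self_count_homo.
  by rewrite truncn_ge_nat //; near: x.
have -> : (2 ^ (self_count u (Y x) - C))%:R
    = expR (ln 2 * (self_count u (Y x) - C)%:R) :> R.
  by rewrite mulrC expRM_natl lnK ?posrE // natrX.
rewrite [leLHS]/= ler_expR; apply: le_trans hx _.
rewrite -mulrBr ler_pM2l //.
(* Natural subtraction truncates at 0, which only helps here. *)
have : ((self_count u (Y x))%:R : R) <= (self_count u (Y x) - C)%:R + C%:R.
  by rewrite -natrD ler_nat; lia.
by lra.
Unshelve. all: by end_near. Qed.

End Analysis.

(* The constant K implied by >>_n depends on n only, hence it is chosen before
   the sequence u. *)
Theorem theorem4 (R : realType) (n : nat) (hn : (0 < n)%N) :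
  exists K : R, 0 < K /\
    forall u : nat -> int, admissible R u ->
      exists x0 c : R, [/\ 0 < x0, 0 < c &
        forall x : R, x0 < x ->
          K * iexp n (c * (iln n.+1 x) ^+ 2) <= (Ucount u x)%:R].
Proof.
exists 1; split=> // u adm.
have [c [c0 [M [_ H]]]] := @self_count_lower R u n adm.
(* The threshold [M] from the filter at infinity may be negative; the maximum with 1 makes it
   positive. *)
exists (Num.max M 1), c; split=> //; first by rewrite lt_max ltr01 orbT.
move=> x; rewrite gt_max => /andP[Mx x1]; rewrite mul1r.
apply: le_trans (H _ Mx) _; rewrite ler_nat.
by apply: self_count_Ucount; rewrite ltW // (lt_trans ltr01).
Qed.
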